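(* Let $G$ be a finite group, let $u:A\to B$ be a Galois morphism of commutative rings with group $G$, and let $\theta:G\to B^{\times}$ be a cocycle. Put $$L_\theta=\{b\in B:\ \forall g\in G,\ \theta(g)\,g(b)=b\}.$$ Then the $A$-module $L_\theta$ is invertible. It is free if and only if it contains an element which is invertible in $B$, in other words if and only if $\theta$ is a coboundary.
   Context: Let $G$ be a finite group. A morphism $u:A\to B$ of commutative rings is called Galois with group $G$ if $G$ acts on $B$ by ring automorphisms in such a way that: (1) $B^G=A$; (2) the ring morphism $\rho_{B,G}:B\otimes_A B\to\prod_G B$, $x\otimes y\mapsto (g\mapsto x\,g(y))$, is an isomorphism; (3) $u$ makes $B$ a finitely generated projective $A$-module (necessarily of rank $\mathrm{Card}(G)$). A cocycle is a map $\theta:G\to B^\times$ such that $\theta(1)=1$ and $\theta(gh)=\theta(g)\cdot g(\theta(h))$ for all $g,h\in G$. A coboundary is a cocycle of the form $\theta(g)=u/g(u)$ for some $u\in B^\times$. An $A$-module is called invertible if it is projective, finitely generated and of rank $1$. Here a finitely generated $A$-module $L$ has rank $n$ if for every prime ideal $\mathfrak{p}$ of $A$, with $\kappa(\mathfrak{p})$ the fraction field of $A/\mathfrak{p}$, the $\kappa(\mathfrak p)$-vector space $(L/\mathfrak{p}L)_{\mathfrak{p}}=\kappa(\mathfrak{p})\otimes_A L$ has dimension $n$. *)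

(* Defs.v *)
From HB Require Import structures.
From mathcomp Require Import all_boot all_fingroup all_algebra.
From mathcomp Require Import generic_quotient boolp.

Set Implicit Arguments.
Unset Strict Implicit.
Unset Printing Implicit Defensive.

Import GRing.Theory.
Local Open Scope ring_scope.
Local Open Scope quotient_scope.

(* Commutative rings are [comPzRingType]s: the zero ring is allowed.  Since    *)
(* [GRing.unit] is only available on nonzero rings, units are defined here.    *)

Record units (R : comPzRingType) := Units {
  uval : R;
  uinv : R;
  uvalK : uval * uinv = 1
}.

Section UnitsMap.
Context (R S : comPzRingType) (f : {rmorphism R -> S}).

Lemma units_map_subproof (v : units R) : f (uval v) * f (uinv v) = 1.
Proof. by rewrite -rmorphM uvalK rmorph1. Qed.

Definition units_map (v : units R) : units S := Units (units_map_subproof v).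

End UnitsMap.

Definition udiv (R : comPzRingType) (v w : units R) : R := uval v * uinv w.

Section Modules.
Context (A : comPzRingType).

Definition finitely_generated (M : lmodType A) : Prop :=
  exists (n : nat) (e : 'I_n -> M),
    forall x, exists c : 'I_n -> A, x = \sum_(i < n) c i *: e i.

Definition projective (P : lmodType A) : Prop :=
  forall (M N : lmodType A) (f : {linear M -> N}) (g : {linear P -> N}),
    (forall y, exists x, f x = y) ->
    exists h : {linear P -> M}, forall x, f (h x) = g x.

Definition is_basis (M : lmodType A) (I : eqType) (e : I -> M) : Prop :=
  (forall (s : seq I) (c : I -> A), uniq s ->
     \sum_(i <- s) c i *: e i = 0 -> {in s, forall i, c i = 0}) /\
  (forall x, exists (s : seq I) (c : I -> A), x = \sum_(i <- s) c i *: e i).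

Definition free_module (M : lmodType A) : Prop :=
  exists (I : eqType) (e : I -> M), is_basis e.

Definition has_dim (M : lmodType A) (n : nat) : Prop :=
  exists e : 'I_n -> M, is_basis e.

End Modules.

(* [restr u] is the codomain of [u] seen as a module over its domain.          *)
Definition restr (A B : comPzRingType) (u : {rmorphism A -> B}) : Type := B.

Section Restr.
Context (A B : comPzRingType) (u : {rmorphism A -> B}).

HB.instance Definition _ := GRing.ComPzRing.on (restr u).

Definition restr_scale (a : A) (b : restr u) : restr u := u a * (b : B).

Lemma restr_scaleA a a' b :
  restr_scale a (restr_scale a' b) = restr_scale (a * a') b.
Proof. by rewrite /restr_scale rmorphM mulrA. Qed.

Lemma restr_scale1 : left_id 1 restr_scale.
Proof. by move=> b; rewrite /restr_scale rmorph1 mul1r. Qed.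

Lemma restr_scaleDr : right_distributive restr_scale +%R.
Proof. by move=> a b b'; rewrite /restr_scale mulrDr. Qed.

Lemma restr_scaleDl b : {morph restr_scale^~ b : a a' / a + a'}.
Proof. by move=> a a'; rewrite /restr_scale rmorphD mulrDl. Qed.

HB.instance Definition _ := GRing.Zmodule_isLmodule.Build A (restr u)
  restr_scaleA restr_scale1 restr_scaleDr restr_scaleDl.

End Restr.

(* The tensor product of an A-algebra K (given by phi : A -> K) with an        *)
(* A-module L, as a K-module: formal sums of pure tensors, represented by      *)
(* sequences of pairs, modulo the smallest congruence making concatenation     *)
(* commutative and the pure tensor biadditive and A-balanced.  Opposites exist *)
(* in the quotient because (- x, y) is one for (x, y).                         *)
Inductive tensor_rel (A K : comPzRingType) (phi : {rmorphism A -> K})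
    (L : lmodType A) : seq (K * L) -> seq (K * L) -> Prop :=
| TensorRefl s : tensor_rel phi s s
| TensorSym s t : tensor_rel phi s t -> tensor_rel phi t s
| TensorTrans s t r :
    tensor_rel phi s t -> tensor_rel phi t r -> tensor_rel phi s r
| TensorCat s s' t t' : tensor_rel phi s s' -> tensor_rel phi t t' ->
    tensor_rel phi (s ++ t) (s' ++ t')
| TensorCatC s t : tensor_rel phi (s ++ t) (t ++ s)
| Tensor0l y : tensor_rel phi [:: (0, y)] [::]
| TensorDl x x' y : tensor_rel phi [:: (x + x', y)] [:: (x, y); (x', y)]
| TensorDr x y y' : tensor_rel phi [:: (x, y + y')] [:: (x, y); (x, y')]
| TensorZ a x y : tensor_rel phi [:: (x * phi a, y)] [:: (x, a *: y)].

Section BaseChange.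
Context (A K : comPzRingType) (phi : {rmorphism A -> K}) (L : lmodType A).

Definition tensor_relb : rel (seq (K * L)) :=
  fun s t => `[< tensor_rel phi s t >].

Lemma tensor_relb_equiv : equiv_class_of tensor_relb.
Proof.
split=> [s|s t|t s r].
- exact/asboolP/TensorRefl.
- by apply/asboolP/asboolP => /TensorSym.
- by move=> /asboolP st /asboolP tr; apply/asboolP/TensorTrans/tr.
Qed.

Canonical tensor_relb_rel := EquivRelPack tensor_relb_equiv.
Canonical tensor_relb_encModRel := defaultEncModRel tensor_relb.

Definition base_change : Type := {eq_quot tensor_relb}.

HB.instance Definition _ : EqQuotient _ tensor_relb base_change :=
  EqQuotient.on base_change.
HB.instance Definition _ := Choice.on base_change.

Definition bc_class (s : seq (K * L)) : base_change := \pi_base_change s.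

Definition tensor (x : K) (y : L) : base_change := bc_class [:: (x, y)].

Lemma bc_classP s t : bc_class s = bc_class t <-> tensor_rel phi s t.
Proof.
split=> [/eqmodP/asboolP //|st]; exact/eqmodP/asboolP.
Qed.

Lemma bc_repr s : tensor_rel phi (repr (bc_class s)) s.
Proof. by apply/bc_classP; rewrite /bc_class reprK. Qed.

Lemma bc_ind (P : base_change -> Prop) : (forall s, P (bc_class s)) ->
  forall t, P t.
Proof. by move=> Ps t; rewrite -[t]reprK; apply: Ps. Qed.

Definition bc_mul (c : K) (s : seq (K * L)) : seq (K * L) :=
  [seq (c * z.1, z.2) | z <- s].

Definition bc_zero : base_change := bc_class [::].
Definition bc_add (t t' : base_change) : base_change :=
  bc_class (repr t ++ repr t').
Definition bc_scale (c : K) (t : base_change) : base_change :=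
  bc_class (bc_mul c (repr t)).
Definition bc_opp (t : base_change) : base_change := bc_scale (- 1) t.

Lemma tensor_rel_mul c s t :
  tensor_rel phi s t -> tensor_rel phi (bc_mul c s) (bc_mul c t).
Proof.
rewrite /bc_mul; elim=> {s t} /=.
- by move=> s; apply: TensorRefl.
- by move=> s t _; apply: TensorSym.
- by move=> s t r _ st _ tr; apply: TensorTrans tr.
- by move=> s s' t t' _ ss _ tt; rewrite !map_cat; apply: TensorCat.
- by move=> s t; rewrite !map_cat; apply: TensorCatC.
- by move=> y; rewrite mulr0; apply: Tensor0l.
- by move=> x x' y; rewrite mulrDr; apply: TensorDl.
- by move=> x y y'; apply: TensorDr.
- by move=> a x y; rewrite mulrA; apply: TensorZ.
Qed.

Lemma bc_addE s t : bc_add (bc_class s) (bc_class t) = bc_class (s ++ t).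
Proof. by apply/bc_classP/TensorCat; apply: bc_repr. Qed.

Lemma bc_scaleE c s : bc_scale c (bc_class s) = bc_class (bc_mul c s).
Proof. exact/bc_classP/tensor_rel_mul/bc_repr. Qed.

Lemma bc_addA : associative bc_add.
Proof.
elim/bc_ind=> s; elim/bc_ind=> t; elim/bc_ind=> r.
by rewrite !bc_addE catA.
Qed.

Lemma bc_addC : commutative bc_add.
Proof.
elim/bc_ind=> s; elim/bc_ind=> t; rewrite !bc_addE.
exact/bc_classP/TensorCatC.
Qed.

Lemma bc_add0 : left_id bc_zero bc_add.
Proof. by elim/bc_ind=> s; rewrite bc_addE. Qed.

Lemma bc_scaleDl t : {morph bc_scale^~ t : c d / c + d >-> bc_add c d}.
Proof.
move=> c d; elim/bc_ind: t => s; rewrite !bc_scaleE bc_addE; apply/bc_classP.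
elim: s => [|[x y] s IHs] /=; first exact: TensorRefl.
rewrite mulrDl; apply: (@TensorTrans _ _ _ _ _
  ([:: (c * x, y); (d * x, y)] ++ (bc_mul c s ++ bc_mul d s))).
  by rewrite -[_ :: bc_mul _ s]cat1s; apply: TensorCat IHs; apply: TensorDl.
rewrite /= -[_ :: _ :: _]cat1s -[(c * x, y) :: (_ ++ _)]cat1s.
apply: TensorCat; first exact: TensorRefl.
rewrite -[_ :: bc_mul d s]cat1s -cat1s !catA.
by apply: TensorCat; [exact: TensorCatC | exact: TensorRefl].
Qed.

Lemma bc_scale0 t : bc_scale 0 t = bc_zero.
Proof.
elim/bc_ind: t => s; rewrite bc_scaleE; apply/bc_classP.
elim: s => [|[x y] s IHs] /=; first exact: TensorRefl.
rewrite mul0r -cat1s -[[::]]/([::] ++ [::]).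
by apply: TensorCat IHs; apply: Tensor0l.
Qed.

Lemma bc_scale1 : left_id 1 bc_scale.
Proof.
elim/bc_ind=> s; rewrite bc_scaleE; congr bc_class.
by rewrite -[RHS]map_id; apply: eq_map => -[x y]; rewrite mul1r.
Qed.

Lemma bc_addN : left_inverse bc_zero bc_opp bc_add.
Proof.
by move=> t; rewrite -{2}[t]bc_scale1 -bc_scaleDl addNr bc_scale0.
Qed.

HB.instance Definition _ := GRing.isZmodule.Build base_change
  bc_addA bc_addC bc_add0 bc_addN.

Lemma bc_scaleA c d t : bc_scale c (bc_scale d t) = bc_scale (c * d) t.
Proof.
elim/bc_ind: t => s; rewrite !bc_scaleE; congr bc_class.
by rewrite /bc_mul -map_comp; apply: eq_map => z /=; rewrite mulrA.
Qed.

Lemma bc_scaleDr : right_distributive bc_scale +%R.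
Proof.
move=> c; elim/bc_ind=> s; elim/bc_ind=> t.
by rewrite [_ + _]bc_addE !bc_scaleE [RHS]bc_addE /bc_mul map_cat.
Qed.

HB.instance Definition _ := GRing.Zmodule_isLmodule.Build K base_change
  bc_scaleA bc_scale1 bc_scaleDr bc_scaleDl.

Lemma tensor_rel_sum (V : zmodType) (f : K -> L -> V) :
    (forall x x' y, f (x + x') y = f x y + f x' y) ->
    (forall x y y', f x (y + y') = f x y + f x y') ->
    (forall a x y, f (x * phi a) y = f x (a *: y)) ->
  forall s t, tensor_rel phi s t ->
  \sum_(z <- s) f z.1 z.2 = \sum_(z <- t) f z.1 z.2.
Proof.
move=> fDl fDr fZ s t; elim=> {s t}.
- by [].
- by move=> s t _ ->.
- by move=> s t r _ -> _ ->.
- by move=> s s' t t' _ ss _ tt; rewrite !big_cat /= ss tt.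
- by move=> s t; rewrite !big_cat /= addrC.
- move=> y; rewrite big_seq1 big_nil /=.
  by apply: (addrI (f 0 y)); rewrite -fDl !addr0.
- by move=> x x' y; rewrite !big_cons !big_nil !addr0 /= fDl.
- by move=> x y y'; rewrite !big_cons !big_nil !addr0 /= fDr.
- by move=> a x y; rewrite !big_seq1 /= fZ.
Qed.

End BaseChange.

Record prime_ideal (A : comPzRingType) := PrimeIdeal {
  in_prime :> A -> Prop;
  prime0 : in_prime 0;
  primeD : forall x y, in_prime x -> in_prime y -> in_prime (x + y);
  primeM : forall a x, in_prime x -> in_prime (a * x);
  prime1 : ~ in_prime 1;
  prime_or : forall x y, in_prime (x * y) -> in_prime x \/ in_prime y
}.

(* A itself; the parameter p provides a proof that it is a nonzero ring.       *)
Definition prime_base (A : comPzRingType) (p : prime_ideal A) : Type := A.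

Section ResidueField.
Context (A : comPzRingType) (p : prime_ideal A).

HB.instance Definition _ := GRing.ComPzRing.on (prime_base p).

Lemma prime_base_oner_neq0 : (1 : prime_base p) != 0.
Proof.
by apply/eqP => e10; apply: (@prime1 A p); rewrite [1]e10; apply: prime0.
Qed.

HB.instance Definition _ :=
  GRing.PzSemiRing_isNonZero.Build (prime_base p) prime_base_oner_neq0.

Definition in_primeb (x : prime_base p) : bool := `[< in_prime p x >].

Lemma in_primeb_idealr : idealr_closed in_primeb.
Proof.
split=> [||a x y /asboolP px /asboolP py].
- exact/asboolP/prime0.
- by apply/asboolP/prime1.
- by apply/asboolP/primeD => //; apply: primeM.
Qed.

HB.instance Definition _ :=
  isIdealr.Build (prime_base p) in_primeb in_primeb_idealr.

Lemma in_primeb_prime : prime_idealr_closed in_primeb.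
Proof.
move=> x y /asboolP/prime_or[] px; apply/orP; [left | right]; exact/asboolP.
Qed.

HB.instance Definition _ :=
  isPrimeIdealrClosed.Build (prime_base p) in_primeb in_primeb_prime.

Definition ideal_of_prime : prime_idealr (prime_base p) := in_primeb.

Definition residue_ring : Type := {ideal_quot ideal_of_prime}.

HB.instance Definition _ := GRing.ComNzRing.on residue_ring.

Definition residue_unit : pred residue_ring :=
  fun x => `[< exists y, y * x = 1 >].

Definition residue_inv (x : residue_ring) : residue_ring :=
  if pselect (exists y, y * x = 1) is left xV then projT1 (cid xV) else x.

Lemma residue_mulVx : {in residue_unit, left_inverse 1 residue_inv *%R}.
Proof.
move=> x /asboolP xU; rewrite /residue_inv.
by case: pselect => // xV; apply: projT2 (cid xV).
Qed.

Lemma residue_unitPl (x y : residue_ring) : y * x = 1 -> residue_unit x.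
Proof. by move=> yx; apply/asboolP; exists y. Qed.

Lemma residue_inv_out : {in [predC residue_unit], residue_inv =1 id}.
Proof.
by move=> x /asboolP xU; rewrite /residue_inv; case: pselect.
Qed.

HB.instance Definition _ := GRing.ComNzRing_hasMulInverse.Build residue_ring
  residue_mulVx residue_unitPl residue_inv_out.

Lemma residue_integral : GRing.integral_domain_axiom residue_ring.
Proof. by move=> x y; apply: Quotient.rquot_IdomainAxiom. Qed.

HB.instance Definition _ :=
  GRing.ComUnitRing_isIntegral.Build residue_ring residue_integral.

Definition residue_field : fieldType := {fraction residue_ring}.

Definition to_residue (a : A) : residue_field :=
  FracField.tofrac (\pi_({ideal_quot ideal_of_prime}) (a : prime_base p)
                     : residue_ring).

Lemma to_residue_zmod : zmod_morphism to_residue.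
Proof.
move=> x y; rewrite /to_residue -[RHS]rmorphB; congr FracField.tofrac.
exact: (pi_is_zmod_morphism {ideal_quot ideal_of_prime}).
Qed.

Lemma to_residue_monoid : monoid_morphism to_residue.
Proof.
have [pi1 piM] := pi_is_monoid_morphism {ideal_quot ideal_of_prime}.
split=> [|x y].
  by rewrite /to_residue -[RHS](rmorph1 (@FracField.tofrac _)) -pi1.
by rewrite /to_residue -[RHS]rmorphM; congr FracField.tofrac; apply: piM.
Qed.

HB.instance Definition _ :=
  GRing.isZmodMorphism.Build A residue_field to_residue to_residue_zmod.
HB.instance Definition _ :=
  GRing.isMonoidMorphism.Build A residue_field to_residue to_residue_monoid.

End ResidueField.

Definition has_rank (A : comPzRingType) (L : lmodType A) (n : nat) : Prop :=
  forall p : prime_ideal A, has_dim (base_change (to_residue p) L) n.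

Definition invertible_module (A : comPzRingType) (L : lmodType A) : Prop :=
  [/\ projective L, finitely_generated L & has_rank L 1].

(* Left actions of the finite group gT on B by ring automorphisms (a ring      *)
(* endomorphism act g is bijective, with inverse act g^-1).                    *)
Record ring_action (gT : finGroupType) (B : comPzRingType) := RingAction {
  act :> gT -> {rmorphism B -> B};
  act1 : forall b, act 1%g b = b;
  actM : forall g h b, act (g * h)%g b = act g (act h b)
}.

Section Galois.
Context (gT : finGroupType) (A B : comPzRingType) (u : {rmorphism A -> B}).
Context (sigma : ring_action gT B).

(* B^G = A, where A is identified with its image by u.                         *)
Definition fixed_ring_is : Prop :=
  injective u /\
  forall b, (forall g, sigma g b = b) <-> (exists a, u a = b).

(* The map B (x)_A B -> \prod_G B, x (x) y |-> (g |-> x * g(y)); the lemmas    *)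
(* below show that it does not depend on the choice of a representative.       *)
Definition galois_map (t : base_change u (restr u)) : {ffun gT -> B} :=
  \sum_(z <- repr t) [ffun g => z.1 * sigma g z.2].

Lemma galois_map_class (s : seq (B * restr u)) : fixed_ring_is ->
  galois_map (bc_class u s) = \sum_(z <- s) [ffun g => z.1 * sigma g z.2].
Proof.
move=> [_ fixu].
apply: (@tensor_rel_sum _ _ u (restr u) {ffun gT -> B}
  (fun x y => [ffun g => x * sigma g y])); last exact: bc_repr.
- by move=> x x' y; apply/ffunP=> g; rewrite !ffunE mulrDl.
- by move=> x y y'; apply/ffunP=> g; rewrite !ffunE rmorphD mulrDr.
- move=> a x y; apply/ffunP=> g; rewrite !ffunE rmorphM mulrA.
  by have /fixu-> : exists a', u a' = u a by exists a.
Qed.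

Lemma galois_map_tensor (x y : B) : fixed_ring_is ->
  galois_map (tensor u x (y : restr u)) = [ffun g => x * sigma g y].
Proof. by move=> fixu; rewrite galois_map_class // big_seq1. Qed.

Lemma galois_mapD : fixed_ring_is -> {morph galois_map : s t / s + t}.
Proof.
move=> fixu; elim/bc_ind=> s; elim/bc_ind=> t.
by rewrite [_ + _]bc_addE !galois_map_class // big_cat.
Qed.

Record galois : Prop := Galois {
  galois_fixed : fixed_ring_is;
  galois_bij : bijective galois_map;
  galois_fg : finitely_generated (restr u);
  galois_proj : projective (restr u)
}.

Record cocycle := Cocycle {
  cocycle_fun :> gT -> units B;
  cocycle1 : uval (cocycle_fun 1%g) = 1;
  cocycleM : forall g h,
    uval (cocycle_fun (g * h)%g) =
    uval (cocycle_fun g) * sigma g (uval (cocycle_fun h))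
}.

Definition coboundary (theta : cocycle) : Prop :=
  exists v : units B, 
    forall g, uval (theta g) = udiv v (units_map (sigma g) v).

End Galois.

Section TwistedForm.
Context (gT : finGroupType) (A B : comPzRingType) (u : {rmorphism A -> B}).
Context (sigma : ring_action gT B) (galu : galois u sigma).
Context (theta : cocycle sigma).

Definition twisted (b : restr u) : bool :=
  [forall g, uval (theta g) * sigma g b == b].

Lemma twisted_submod : subsemimod_closed (twisted : {pred restr u}).
Proof.
have [_ fixu] := galois_fixed galu.
split=> [|a b /forallP bP]; last first.
  apply/forallP=> g; rewrite [a *: b]/(u a * b) rmorphM mulrCA (eqP (bP g)).
  by have /fixu-> : exists a', u a' = u a by exists a.
split=> [|b c /forallP bP /forallP cP]; apply/forallP=> g.
  by rewrite rmorph0 mulr0.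
by rewrite rmorphD mulrDr (eqP (bP g)) (eqP (cP g)).
Qed.

End TwistedForm.

(* The submodule L_theta.  The Galois hypothesis is needed for it to be stable *)
(* under scaling by A, hence the extra parameter.                              *)
Definition in_Ltheta (gT : finGroupType) (A B : comPzRingType)
    (u : {rmorphism A -> B}) (sigma : ring_action gT B)
    (galu : galois u sigma) (theta : cocycle sigma) (b : restr u) : bool :=
  twisted theta b.

Section Ltheta.
Context (gT : finGroupType) (A B : comPzRingType) (u : {rmorphism A -> B}).
Context (sigma : ring_action gT B) (galu : galois u sigma).
Context (theta : cocycle sigma).

HB.instance Definition _ := GRing.isSubmodClosed.Build A (restr u)
  (in_Ltheta galu theta) (twisted_submod galu theta).

Definition Ltheta : Type := {b : restr u | in_Ltheta galu theta b}.

HB.instance Definition _ := SubChoice.on Ltheta.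
HB.instance Definition _ := [SubChoice_isSubLmodule of Ltheta by <:].

End Ltheta.

(* Main.v *)
Require Import Defs.
From HB Require Import structures.
From mathcomp Require Import all_boot all_fingroup all_algebra.
From mathcomp Require Import boolp.

(** Surjectivity of B (x)_A B -> \prod_G B gives x_i, y_i in B such that
    \sum_i x_i g(y_i) is 1 for g = 1 and 0 otherwise.  Hence
    b = \sum_i x_i tr(y_i b) for all b, and the determinant trick applied to the
    ideal tr(B) of A provides c with tr(c) = 1.  The twisted traces
    l_i = \sum_g theta(g) g(x_i) and m_i = \sum_g theta(g)^-1 g(c y_i) lie in
    L_theta and L_(theta^-1), and \sum_i l_i m_i = tr(c) = 1.  Multiplication by
    m_i maps L_theta to B^G = A, and everything follows from this dual basis
    with the exchange rule (l m) l' = (l' m) l. *)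

Set Implicit Arguments.
Unset Strict Implicit.
Unset Printing Implicit Defensive.

Import GRing.Theory.
Local Open Scope ring_scope.

(** * Dual bases, and the rank and freeness they give under the exchange rule *)

Section DualPairing.
Context (A : comPzRingType) (M : lmodType A) (n : nat).
Context (e : 'I_n -> M) (f : 'I_n -> {scalar M}).

Lemma dual_basis_finitely_generated :
  (forall x, x = \sum_(i < n) f i x *: e i) -> finitely_generated M.
Proof. by move=> fe; exists n, e => x; exists (f^~ x). Qed.

Lemma dual_basis_projective :
  (forall x, x = \sum_(i < n) f i x *: e i) -> projective M.
Proof.
move=> fe X Y p q p_surj.
have [w pw] := choice (fun i => p_surj (q (e i))).
pose h x := \sum_(i < n) f i x *: w i.
have h_lin : linear h.
  move=> a x y; rewrite /h scaler_sumr -big_split; apply: eq_bigr => i _.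
  by rewrite linearP scalerDl scalerA.
pose hL : {linear M -> X} := HB.pack h (GRing.isLinear.Build A M X _ h h_lin).
exists hL => x /=.
rewrite {2}[x]fe /h !linear_sum; apply: eq_bigr => i _.
by rewrite !linearZ /= pw.
Qed.

Hypothesis fe1 : \sum_(i < n) f i (e i) = 1.
Hypothesis f_exchange : forall i x y, f i x *: y = f i y *: x.

Lemma exchange_dual_basis x : x = \sum_(i < n) f i x *: e i.
Proof.
rewrite -{1}[x]scale1r -fe1 scaler_suml.
by apply: eq_bigr => i _; apply: f_exchange.
Qed.

(** Since the [f i (e i)] sum to 1, one of them, [a], is nonzero in the residue field, and
    [1 (x) e i] is then a basis of the fibre. *)
Lemma exchange_has_rank1 : has_rank M 1.
Proof.
move=> p; set phi := to_residue p.
have [i fei0] : exists i, phi (f i (e i)) != 0.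
  apply/existsP; apply: contraT => /existsPn phi0.
  have /eqP[] := oner_neq0 (residue_field p).
  rewrite -(rmorph1 phi) -fe1 rmorph_sum big1 // => j _.
  exact/eqP/negPn/phi0.
set a := f i (e i) in fei0.
(* The functional induced by [f i] on the fibre, given on pure tensors; it sends [1 (x) e i] to
   [phi a], a unit, which yields independence. *)
pose ev (x : residue_field p) y := x * phi (f i y).
have evE s t : bc_class phi s = bc_class phi t ->
    \sum_(z <- s) ev z.1 z.2 = \sum_(z <- t) ev z.1 z.2.
  move=> /bc_classP; apply: tensor_rel_sum => [x x' y|x y y'|b x y].
  - by rewrite /ev mulrDl.
  - by rewrite /ev -mulrDr -rmorphD linearD.
  - by rewrite /ev -mulrA -rmorphM linearZ.
exists (fun=> tensor phi 1 (e i)); split=> [s c s_uniq|].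
  have s1 : (size s <= 1)%N.
    by rewrite -(card_uniqP s_uniq) -[leqRHS](card_ord 1) max_card.
  case: s s1 {s_uniq} => [|j [|//]] _ //.
  rewrite big_seq1 [_ *: _]bc_scaleE => /evE; rewrite big_seq1 big_nil /ev /=.
  rewrite mulr1 => /eqP; rewrite mulf_eq0 (negPf fei0) orbF => /eqP cj0 k.
  by rewrite inE => /eqP->.
elim/bc_ind=> s.
exists [:: ord0], (fun=> \sum_(z <- s) (phi a)^-1 * ev z.1 z.2).
rewrite big_seq1; elim: s => [|[x y] s IHs].
  by rewrite big_nil scale0r.
rewrite big_cons scalerDl -IHs -cat1s -[LHS]bc_addE; congr (_ + _).
rewrite [RHS]bc_scaleE; apply/bc_classP; rewrite /ev /= mulr1.
(* With z = x / phi(a), this is the chain x (x) y = z (x) f_i(e_i) y = z (x) f_i(y) e_i = z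
   phi(f_i(y)) (x) e_i. *)
rewrite -{1}[x](mulVKf fei0) mulrCA [phi a * x]mulrC.
rewrite 2!mulrA.
apply: TensorTrans (TensorZ _ _ _ _) _.
rewrite f_exchange; apply: TensorSym; exact: TensorZ.
Qed.

Lemma exchange_invertible : invertible_module M.
Proof.
have fe := exchange_dual_basis.
split; [exact: dual_basis_projective | exact: dual_basis_finitely_generated |].
exact: exchange_has_rank1.
Qed.

(** If A is nonzero, a basis has at most one element: given a second one, exchange makes every f_k
    vanish on the first, which is then 0 by the dual basis formula. Asking only for a generator also
    covers the zero ring. *)
Lemma exchange_free_cyclic : free_module M ->
  exists x : M, forall y, exists a, y = a *: x.
Proof.
case=> I [b [b_free b_span]].
have b_neq0 i : b i = 0 -> (1 : A) = 0.
  move=> bi0; apply: (b_free [:: i] (fun=> 1)) (mem_head _ _) => //.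
  by rewrite big_seq1 bi0 scaler0.
have [A0|A_neq0] := pselect ((1 : A) = 0).
  by exists 0 => y; exists 0; rewrite -[y]scale1r A0 !scale0r.
have b_eq (i j : I) : i = j.
  apply/eqP/negPn/negP => neq_ij; apply: A_neq0; apply: (b_neq0 i).
  rewrite [b i]exchange_dual_basis big1 // => k _.
  (* By exchange, f_k(b_j) b_i - f_k(b_i) b_j = 0 is a relation in the basis. *)
  pose c l := if l == i then f k (b j) else - f k (b i).
  have ck0 : - f k (b i) = 0.
    have := b_free [:: i; j] c; rewrite /= inE neq_ij => /(_ isT).
    rewrite big_cons big_seq1 /c eqxx eq_sym (negPf neq_ij) scaleNr.
    rewrite f_exchange subrr => /(_ erefl) /(_ j).
    by rewrite !inE eqxx orbT eq_sym (negPf neq_ij); apply.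
  by rewrite -[f k _]opprK ck0 oppr0 scale0r.
have [i|noI] := pselect (inhabited I); last first.
  exists 0 => y; exists 0; have [[|i s] [c ->]] := b_span y.
    by rewrite big_nil scaler0.
  by case: noI.
case: i => i; exists (b i) => y; have [s [c ->]] := b_span y.
exists (\sum_(j <- s) c j); rewrite scaler_suml.
by apply: eq_bigr => j _; rewrite (b_eq j i).
Qed.

End DualPairing.

(** * The trace of a Galois morphism and its surjectivity onto the invariants *)

Section GaloisTheory.
Context (gT : finGroupType) (A B : comPzRingType) (u : {rmorphism A -> B}).
Context (sigma : ring_action gT B) (galu : galois u sigma).

Definition trace (b : B) : B := \sum_g sigma g b.

Lemma act_trace g b : sigma g (trace b) = trace b.
Proof.
rewrite /trace rmorph_sum [RHS](reindex_inj (mulgI g)).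
by apply: eq_bigr => h _; rewrite Defs.actM.
Qed.

Lemma act_uinv_uval g (v : units B) : sigma g (uinv v) * sigma g (uval v) = 1.
Proof. by rewrite -rmorphM mulrC uvalK rmorph1. Qed.

Lemma traceB b c : trace (b - c) = trace b - trace c.
Proof. by rewrite /trace -sumrB; apply: eq_bigr => g _; rewrite rmorphB. Qed.

Lemma traceD b c : trace (b + c) = trace b + trace c.
Proof.
by rewrite /trace -big_split; apply: eq_bigr => g _; rewrite rmorphD.
Qed.

Lemma traceMl a b : (forall g, sigma g a = a) -> trace (a * b) = a * trace b.
Proof.
move=> fa; rewrite /trace mulr_sumr.
by apply: eq_bigr => g _; rewrite rmorphM fa.
Qed.

Lemma galois_coordinates : exists (n : nat) (x y : 'I_n -> B),
  forall g, \sum_(i < n) x i * sigma g (y i) = (g == 1%g)%:R.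
Proof.
have [inv _ invK] := galois_bij galu.
pose delta : {ffun gT -> B} := [ffun g => (g == 1%g)%:R].
have [s s_delta] : exists s, galois_map sigma (bc_class u s) = delta.
  by elim/bc_ind: (inv delta) (invK delta) => s; exists s.
pose z i := tnth (in_tuple s) i.
exists (size s), (fun i => (z i).1), (fun i => (z i).2) => g.
move: s_delta; rewrite (galois_map_class _ (galois_fixed galu)).
move/ffunP/(_ g); rewrite ffunE sum_ffunE => <-.
by rewrite [RHS]big_tnth; apply: eq_bigr => i _; rewrite ffunE.
Qed.

(** Congruence modulo the ideal tr(B) of B^G, phrased inside B so that it applies to matrices over
    B. Invariance of both sides makes it multiplicative, by [traceMl]. *)
Definition congr_trace (a b : B) : Prop :=
  [/\ forall g, sigma g a = a, forall g, sigma g b = b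
    & exists c, a - b = trace c].

Lemma congr_trace_refl a : (forall g, sigma g a = a) -> congr_trace a a.
Proof.
by move=> fa; split=> //; exists (0 - 0); rewrite traceB !subrr.
Qed.

Lemma congr_traceD a b a' b' :
  congr_trace a b -> congr_trace a' b' -> congr_trace (a + a') (b + b').
Proof.
move=> [fa fb [c abc]] [fa' fb' [c' abc']]; split=> [g|g|].
- by rewrite rmorphD fa fa'.
- by rewrite rmorphD fb fb'.
- by exists (c + c'); rewrite traceD -abc -abc' opprD addrACA.
Qed.

Lemma congr_traceM a b a' b' :
  congr_trace a b -> congr_trace a' b' -> congr_trace (a * a') (b * b').
Proof.
move=> [fa fb [c abc]] [fa' fb' [c' abc']]; split=> [g|g|].
- by rewrite rmorphM fa fa'.
- by rewrite rmorphM fb fb'.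
(* From a a' - b b' = a (a' - b') + b' (a - b). *)
- exists (a * c' + b' * c); rewrite traceD !traceMl // -abc -abc'.
  by rewrite !mulrBr addrA [b' * a]mulrC subrK [b' * b]mulrC.
Qed.

Lemma congr_trace_det n (P Q : 'M[B]_n) :
  (forall i j, congr_trace (P i j) (Q i j)) -> congr_trace (\det P) (\det Q).
Proof.
move=> PQ; apply: (big_ind2 congr_trace) => [||s _].
- by apply: congr_trace_refl => g; rewrite rmorph0.
- by move=> *; apply: congr_traceD.
apply: congr_traceM.
  by apply: congr_trace_refl => g; rewrite rmorphXn rmorphN1.
apply: (big_ind2 congr_trace) => [|*|i _]; last exact: PQ.
- by apply: congr_trace_refl => g; rewrite rmorph1.
- exact: congr_traceM.
Qed.

(** The row x satisfies x = x P with P = (tr(y_i x_j)), so det(1 - P) kills every x_i, hence also 1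
    = \sum_i x_i tr(y_i). But det(1 - P) is congruent to 1 modulo tr(B). *)
Lemma trace_onto1 : exists c, trace c = 1.
Proof.
have [n [x [y xy]]] := galois_coordinates.
have xtr b : b = \sum_(i < n) x i * trace (y i * b).
  (* After exchanging sums, g(b) has coefficient \sum_i x_i g(y_i), so only g = 1 survives. *)
  under eq_bigr do rewrite /trace mulr_sumr.
  rewrite exchange_big (bigD1 1%g) //= [X in _ + X]big1 => [|g g1].
    rewrite addr0.
    under eq_bigr do rewrite rmorphM mulrA.
    by rewrite -mulr_suml xy eqxx mul1r Defs.act1.
  under eq_bigr do rewrite rmorphM mulrA.
  by rewrite -mulr_suml xy (negPf g1) mul0r.
pose P : 'M[B]_n := \matrix_(i, j) trace (y i * x j).
have xP0 : (\row_i x i) *m (1%:M - P) = 0.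
  apply/rowP=> j; rewrite mulmxBr mulmx1 !mxE [X in X - _]xtr.
  by apply/eqP; rewrite subr_eq0; apply/eqP/eq_bigr => i _; rewrite !mxE.
have det0 : \det (1%:M - P) = 0.
  have xdet i : \det (1%:M - P) * x i = 0.
    have : (\row_i x i) *m (1%:M - P) *m \adj (1%:M - P) = 0.
      by rewrite xP0 mul0mx.
    rewrite -mulmxA mul_mx_adj mul_mx_scalar => /rowP/(_ i).
    by rewrite !mxE.
  rewrite -[LHS]mulr1 [X in _ * X]xtr mulr_sumr big1 // => i _.
  by rewrite mulrA xdet mul0r.
have [_ _ [c]] : congr_trace (\det (1%:M : 'M[B]_n)) (\det (1%:M - P)).
  apply: congr_trace_det => i j; split=> [g|g|].
  - by rewrite mxE rmorph_nat.
  - by rewrite !mxE rmorphB rmorph_nat act_trace.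
  - by exists (y i * x j); rewrite !mxE subKr.
by rewrite det1 det0 subr0; exists c.
Qed.

(** The inverse of [u] on its image B^G, with default value 0 elsewhere. *)
Definition fixed_preimage (b : B) : A :=
  if pselect (exists a, u a = b) is left a_b then projT1 (cid a_b) else 0.

Lemma fixed_preimageK b :
  (forall g, sigma g b = b) -> u (fixed_preimage b) = b.
Proof.
have [_ fixu] := galois_fixed galu => /fixu a_b.
by rewrite /fixed_preimage; case: pselect => // a_b'; case: (cid _).
Qed.

(** * The module L_theta and its pairing with L_(theta^-1) *)

Context (theta : cocycle sigma).
Local Notation L := (Ltheta galu theta).

Definition Ltheta_val (l : L) : B := val l.

Lemma Ltheta_val_inj : injective Ltheta_val.
Proof. exact: val_inj. Qed.

Lemma Ltheta_val0 : Ltheta_val 0 = 0.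
Proof. by []. Qed.

Lemma Ltheta_valD l l' : Ltheta_val (l + l') = Ltheta_val l + Ltheta_val l'.
Proof. by []. Qed.

Lemma Ltheta_valZ a (l : L) : Ltheta_val (a *: l) = u a * Ltheta_val l.
Proof. by []. Qed.

Lemma Ltheta_act l g : uval (theta g) * sigma g (Ltheta_val l) = Ltheta_val l.
Proof. exact/eqP/(forallP (valP l)). Qed.

Lemma in_LthetaP (b : B) : (forall g, uval (theta g) * sigma g b = b) ->
  in_Ltheta galu theta b.
Proof. by move=> lb; apply/forallP=> g; apply/eqP. Qed.

(** Membership in L_(theta^-1) with the inverse cleared, which avoids building the inverse
    cocycle. *)
Definition in_Ltheta_dual (m : B) : Prop :=
  forall g, sigma g m = uval (theta g) * m.

Lemma Ltheta_dual_fixed (l : L) m : in_Ltheta_dual m ->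
  forall g, sigma g (Ltheta_val l * m) = Ltheta_val l * m.
Proof.
by move=> m_dual g; rewrite rmorphM m_dual mulrCA mulrA Ltheta_act.
Qed.

(** Inverting theta(g) g(v) = v. Pairing with v^-1 will give the coordinate along v. *)
Lemma Ltheta_unit_dual l (v : units B) :
  Ltheta_val l = uval v -> in_Ltheta_dual (uinv v).
Proof.
move=> lv g; rewrite -[LHS]mulr1 -(uvalK v) -lv -(Ltheta_act l g) lv.
by rewrite [uval (theta g) * _ in LHS]mulrC -mulrA mulrA act_uinv_uval mul1r.
Qed.

Section Pairing.
Context (m : B) (m_dual : in_Ltheta_dual m).

(** The proof of duality is an argument so that the linear structure, which depends on it, can be
    attached to this map. *)
Definition Ltheta_pairing of in_Ltheta_dual m :=
  fun l : L => fixed_preimage (Ltheta_val l * m) : A.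

Lemma Ltheta_pairingE l : u (Ltheta_pairing m_dual l) = Ltheta_val l * m.
Proof. exact/fixed_preimageK/Ltheta_dual_fixed. Qed.

Lemma Ltheta_pairing_linear : linear (Ltheta_pairing m_dual : L -> A^o).
Proof.
have [u_inj _] := galois_fixed galu.
move=> a l l'; apply: u_inj.
rewrite rmorphD rmorphM !Ltheta_pairingE.
by rewrite Ltheta_valD Ltheta_valZ mulrDl mulrA.
Qed.

HB.instance Definition _ :=
  GRing.isLinear.Build A L A^o _ (Ltheta_pairing m_dual) Ltheta_pairing_linear.

(** In the commutative ring B both sides are the product l l' m. *)
Lemma Ltheta_pairing_exchange (l l' : L) :
  Ltheta_pairing m_dual l *: l' = Ltheta_pairing m_dual l' *: l.
Proof.
apply: Ltheta_val_inj; rewrite !Ltheta_valZ !Ltheta_pairingE.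
by rewrite mulrAC [RHS]mulrC mulrA [X in X * _]mulrC.
Qed.

End Pairing.

(** The trace for the twisted action b |-> theta(g) g(b), an action by the cocycle identity, whose
    invariants form L_theta. *)
Definition Ltheta_trace (b : B) : B := \sum_g uval (theta g) * sigma g b.

Lemma Ltheta_trace_in b : in_Ltheta galu theta (Ltheta_trace b).
Proof.
apply: in_LthetaP => h.
rewrite /Ltheta_trace rmorph_sum mulr_sumr [RHS](reindex_inj (mulgI h)).
by apply: eq_bigr => g _; rewrite rmorphM mulrA -cocycleM Defs.actM.
Qed.

Definition Ltheta_dual_trace (b : B) : B := \sum_g uinv (theta g) * sigma g b.

Lemma uinv_cocycle g h :
  sigma g (uinv (theta h)) = uval (theta g) * uinv (theta (g * h)%g).
Proof.
rewrite -[LHS]mulr1 -(uvalK (theta (g * h)%g)) cocycleM.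
by rewrite [uval (theta g) * _ in LHS]mulrC -mulrA mulrA act_uinv_uval mul1r.
Qed.

Lemma Ltheta_dual_trace_in b : in_Ltheta_dual (Ltheta_dual_trace b).
Proof.
move=> h; rewrite /Ltheta_dual_trace rmorph_sum mulr_sumr.
rewrite [RHS](reindex_inj (mulgI h)).
by apply: eq_bigr => g _; rewrite rmorphM uinv_cocycle mulrA Defs.actM.
Qed.

(** The sum expands into terms theta(g) theta(h)^-1 h(c) g(\sum_i x_i (g^-1 h)(y_i)), which vanish
    for h != g; the diagonal ones add up to tr(c). *)
Lemma Ltheta_partition_of_unity :
  exists (n : nat) (l : 'I_n -> L) (m : 'I_n -> B),
    (forall i, in_Ltheta_dual (m i)) /\ \sum_(i < n) Ltheta_val (l i) * m i = 1.
Proof.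
have [n [x [y xy]]] := galois_coordinates; have [c c1] := trace_onto1.
exists n, (fun i => Sub _ (Ltheta_trace_in (x i))).
(* Without the weight c the sum would be Card(G), which need not be invertible. *)
exists (fun i => Ltheta_dual_trace (c * y i)); split=> [i|].
  exact: Ltheta_dual_trace_in.
under eq_bigr do
  rewrite [Ltheta_val _]SubK /Ltheta_trace /Ltheta_dual_trace mulr_suml.
rewrite exchange_big -c1; apply: eq_bigr => g _ /=.
under eq_bigr do rewrite mulr_sumr.
rewrite exchange_big /= (bigD1 g) //= [X in _ + X]big1 ?addr0 => [|h hg].
  transitivity (uval (theta g) * uinv (theta g) * sigma g c *
     sigma g (\sum_(i < n) x i * sigma 1%g (y i))).
    rewrite rmorph_sum mulr_sumr; apply: eq_bigr => i _.
    rewrite Defs.act1 !rmorphM -!mulrA; congr (_ * _).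
    by rewrite mulrCA; congr (_ * _); rewrite mulrCA.
  by rewrite uvalK mul1r xy eqxx rmorph1 mulr1.
transitivity (uval (theta g) * uinv (theta h) * sigma h c *
   sigma g (\sum_(i < n) x i * sigma (g^-1 * h)%g (y i))).
  rewrite rmorph_sum mulr_sumr; apply: eq_bigr => i _.
  rewrite !rmorphM -Defs.actM mulKVg -!mulrA; congr (_ * _).
  by rewrite mulrCA; congr (_ * _); rewrite mulrCA.
by rewrite xy -eq_mulVg1 eq_sym (negPf hg) rmorph0 mulr0.
Qed.

End GaloisTheory.

Theorem proposition10p5 (gT : finGroupType) (A B : comPzRingType)
    (u : {rmorphism A -> B}) (sigma : ring_action gT B)
    (galu : galois u sigma) (theta : cocycle sigma) :
  invertible_module (Ltheta galu theta) /\
  (free_module (Ltheta galu theta) <->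
     exists (b : Ltheta galu theta) (v : units B), val b = uval v) /\
  ((exists (b : Ltheta galu theta) (v : units B), val b = uval v) <->
     coboundary theta).
Proof.
have [u_inj _] := galois_fixed galu.
have [n [l [m [m_dual lm1]]]] := Ltheta_partition_of_unity galu theta.
pose f i : {scalar (Ltheta galu theta)} :=
  @Ltheta_pairing _ _ _ _ _ galu theta _ (m_dual i).
have fl1 : \sum_(i < n) f i (l i) = 1.
  apply: u_inj; rewrite rmorph_sum rmorph1 -lm1; apply: eq_bigr => i _.
  exact: Ltheta_pairingE.
have f_exchange i : forall x y, f i x *: y = f i y *: x.
  exact: Ltheta_pairing_exchange.
split; first exact: exchange_invertible fl1 f_exchange.
split; split.
- move=> /(exchange_free_cyclic fl1 f_exchange)[b b_gen].
  have [a la] := choice (fun i => b_gen (l i)).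
  (* Substituting l_i = a_i b in \sum_i l_i m_i = 1 exhibits an inverse of the generator b. *)
  have bV : Ltheta_val b * (\sum_(i < n) u (a i) * m i) = 1.
    rewrite -lm1 mulr_sumr; apply: eq_bigr => i _.
    by rewrite la Ltheta_valZ mulrCA mulrA.
  by exists b, (Units bV).
- move=> [b [v bv]]; exists unit, (fun=> b); split=> [s c s_uniq|x].
    have s1 : (size s <= 1)%N
      by rewrite -card_unit -(card_uniqP s_uniq) max_card.
    case: s s1 {s_uniq} => [|[] [|//]] _ //.
    rewrite big_seq1 => /(congr1 (@Ltheta_val _ _ _ _ _ galu theta)).
    rewrite Ltheta_valZ Ltheta_val0 [Ltheta_val b]bv.
    move=> /(congr1 (fun z : B => z * uinv v)); rewrite -mulrA uvalK mulr1.
    rewrite mul0r -(rmorph0 u) => /u_inj c0 [] _; exact: c0.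
  (* The coordinate of x along b is x v^-1, which is invariant and hence comes from A. *)
  have v_dual := Ltheta_unit_dual (bv : Ltheta_val b = uval v).
  exists [:: tt], (fun=> Ltheta_pairing v_dual x); rewrite big_seq1.
  apply: Ltheta_val_inj; rewrite Ltheta_valZ Ltheta_pairingE [Ltheta_val b]bv.
  by rewrite -mulrA [uinv v * _]mulrC uvalK mulr1.
(* For a unit v, the equation theta(g) g(v) = v defining L_theta is the coboundary formula theta(g)
   = v / g(v). *)
- move=> [b [v bv]]; exists v => g; have := Ltheta_act b g.
  rewrite [Ltheta_val b]bv /udiv /= => <-.
  by rewrite -mulrA -rmorphM uvalK rmorph1 mulr1.
- move=> [v theta_v]; suff vL : in_Ltheta galu theta (uval v).
    by exists (Sub (uval v : restr u) vL), v; rewrite SubK.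
  apply: in_LthetaP => g; rewrite theta_v /udiv /= -mulrA -rmorphM.
  by rewrite [uinv v * _]mulrC uvalK rmorph1 mulr1.
Qed.
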